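(* Let $U\in\mathcal{CU}_\mu(\mathcal H)$, let $\chi$ be a partition of $\mathbb N_0$ and let $\kappa$ be a subpartition of $\chi$. Then for every $n\ge1$ $$\mathfrak h(U,\chi,n)\le\mathfrak h(U,\kappa,n).$$
   Context: Let $\mu_j>0$ ($j\in\mathbb N_0=\{0,1,\dots\}$) with $\sum_j\mu_j=1$. $\mathcal H=l^2(\mathbb N_0,\mu)$ is the Hilbert space of complex sequences with $\langle x,y\rangle=\sum_j\mu_jx_j\overline{y_j}$, $\|x\|=\sqrt{\langle x,x\rangle}$. $\mathcal{CU}_\mu(\mathcal H)$ is the set of bounded linear operators $U$ on $\mathcal H$ with $\|Ux\|\le\|x\|$ for all $x$. Matrix entries: $(Ux)_j=\sum_kU_{jk}x_k$. Put $\mathbf B=b(U)$ with $\mathbf B_{jk}=\frac{\mu_j}{\mu_k}|U_{jk}|^2$. A partition of $\mathbb N_0$ is a finite collection of pairwise disjoint subsets with union $\mathbb N_0$; $\kappa$ is a subpartition (refinement) of $\chi$ if every element of $\kappa$ is contained in some element of $\chi$. For a partition $\chi=\{X_0,\dots,X_K\}$ let $\mathcal S_{n,K}$ be the set of all maps $\sigma:\{0,\dots,n\}\to\{0,\dots,K\}$, and put $$\mathcal I_U(\mathbf G_\sigma(\chi))=\sum_{j_0,\dots,j_n\in\mathbb N_0}\mathbf 1_{X_{\sigma(n)}}(j_n)\,\mathbf B_{j_nj_{n-1}}\mathbf 1_{X_{\sigma(n-1)}}(j_{n-1})\cdots\mathbf B_{j_1j_0}\mathbf 1_{X_{\sigma(0)}}(j_0)\,\mu_{j_0},$$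 $$\mathfrak h(U,\chi,n)=-\sum_{\sigma\in\mathcal S_{n,K}}\mathcal I_U(\mathbf G_\sigma(\chi))\log\mathcal I_U(\mathbf G_\sigma(\chi)),\qquad 0\log0=0 .$$ *)

(* Defs.v *)
From HB Require Import structures.
From mathcomp Require Import all_boot all_order all_algebra ring lra.
From mathcomp Require Import complex.
From mathcomp Require Import all_classical all_reals all_analysis.

Set Implicit Arguments.
Unset Strict Implicit.
Unset Printing Implicit Defensive.

Import Order.TTheory GRing.Theory Num.Theory.
Import numFieldNormedType.Exports.
Import ComplexField.Normc.

Local Open Scope classical_set_scope.
Local Open Scope ring_scope.

(* The library attaches the norm topology to the sort of an abstract
   numFieldType; these instances make it available on the concrete R[i]. *)
HB.instance Definition _ (R : realType) :=
  NormedModule.copy R[i] ((R[i] : numFieldType)^o).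
HB.instance Definition _ (R : realType) := Num.ClosedField.on R[i].

Record prob_weight (R : realType) := ProbWeight {
  weight_val :> nat -> R;
  weight_gt0 : forall j, 0 < weight_val j;
  weight_sum1 : series weight_val @ \oo --> (1 : R)
}.

Section l2_space.
Context {R : realType} (mu : prob_weight R).

(* normc z : R is the modulus of z : R[i]. *)
Definition l2_pred : {pred nat -> R[i]} :=
  fun x => `[< cvgn (series (fun j => mu j * normc (x j) ^+ 2)) >].

Lemma l2_term_ge0 (x : nat -> R[i]) j : 0 <= mu j * normc (x j) ^+ 2.
Proof. by rewrite mulr_ge0// ?sqr_ge0// ltW// weight_gt0. Qed.

Lemma l2_submod_closed : submod_closed l2_pred.
Proof.
split=> [|a x y].
  apply/asboolP; rewrite (_ : (fun j => _) = cst 0); last first.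
    by apply/funext => j /=; rewrite -[LHS]/(mu j * normc 0%C ^+ 2)
       normc0 expr0n mulr0.
  rewrite (_ : series _ = cst 0); first exact: is_cvg_cst.
  by apply/funext => n; rewrite /series /= big1.
move=> /asboolP sx /asboolP sy; apply/asboolP.
pose b j := (2 * normc a ^+ 2) *: (mu j * normc (x j) ^+ 2) +
            2 *: (mu j * normc (y j) ^+ 2).
apply: (@series_le_cvg _ _ b) => [j|j|j|].
- exact: l2_term_ge0.
- by rewrite addr_ge0// mulr_ge0 ?l2_term_ge0// mulr_ge0// sqr_ge0.
- have nc0 z : 0 <= normc z :> R by case: z => ? ?; exact: sqrtr_ge0.
  have uv : normc (a * x j + y j) <= normc a * normc (x j) + normc (y j).
    by rewrite -normcM; exact: le_normcD.
  have uv2 : normc (a * x j + y j) ^+ 2 <=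
      2 * normc a ^+ 2 * normc (x j) ^+ 2 + 2 * normc (y j) ^+ 2.
    apply: (@le_trans _ _ ((normc a * normc (x j) + normc (y j)) ^+ 2)).
      by rewrite ler_sqr// nnegrE ?addr_ge0// mulr_ge0.
    have := sqr_ge0 (normc a * normc (x j) - normc (y j)); lra.
  have -> : b j = mu j * (2 * normc a ^+ 2 * normc (x j) ^+ 2 +
                          2 * normc (y j) ^+ 2).
    rewrite /b /GRing.scale /=; ring.
  by rewrite ler_pM2l// weight_gt0.
- exact: (is_cvg_seriesD (is_cvg_seriesZ sx) (is_cvg_seriesZ sy)).
Qed.

HB.instance Definition _ :=
  GRing.isSubmodClosed.Build R[i] (nat -> R[i]) l2_pred l2_submod_closed.

Record l2 := L2 { l2_val :> nat -> R[i]; l2_valP : l2_val \in l2_pred }.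

HB.instance Definition _ := [isSub for l2_val].
HB.instance Definition _ := [Choice of l2 by <:].
HB.instance Definition _ := [SubChoice_isSubLmodule of l2 by <:].

Definition l2_inner (x y : l2) : R[i] :=
  limn (series (fun j => (mu j)%:C%C * x j * ((y j)^*)%C)).

Definition l2_norm (x : l2) : R := Num.sqrt (complex.Re (l2_inner x x)).

Lemma l2_delta_subproof (k : nat) :
  (fun j => (j == k)%:R : R[i]) \in l2_pred.
Proof.
apply/asboolP; apply/cvg_ex.
exists (\sum_(0 <= j < k.+1) mu j * normc ((j == k)%:R : R[i]) ^+ 2).
apply: cvg_near_cst; exists k.+1 => // n /= kn.
rewrite /series /= (big_cat_nat (n := k.+1))//= [X in _ + X]big1_seq ?addr0//.
move=> j /andP[_]; rewrite mem_index_iota => /andP[kj _].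
by rewrite gtn_eqF// -[LHS]/(mu j * normc 0%C ^+ 2) normc0 expr0n mulr0.
Qed.

Definition l2_delta (k : nat) : l2 := L2 (l2_delta_subproof k).

(* The bound below is boundedness with constant 1, so linear maps satisfying it
   are exactly the bounded operators of norm at most 1. *)
Definition is_l2_contraction (U : {linear l2 -> l2}) : Prop :=
  forall x : l2, l2_norm (U x) <= l2_norm x.

(* U_jk is the j-th coordinate of the image of the k-th unit sequence; lemma
   mxentryP shows (U x)_j = \sum_k U_jk x_k for all x. *)
Definition mxentry (U : {linear l2 -> l2}) (j k : nat) : R[i] :=
  U (l2_delta k) j.

Definition Bmx (U : {linear l2 -> l2}) (j k : nat) : R :=
  mu j / mu k * normc (mxentry U j k) ^+ 2.

Lemma cvg_real_complex (u : nat -> R) (l : R) :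
  u @ \oo --> l -> (fun n => (u n)%:C%C) @ \oo --> (l%:C%C : R[i]).
Proof.
move=> ul; apply/cvgrPdist_lt => -[e1 e2] /= e0.
have [/eqP e20 e10] : e2 == 0 /\ 0 < e1.
  by move: e0; rewrite ltcE /= => /andP[].
move/cvgrPdist_lt : ul => /(_ e1 e10); apply: filterS => n h.
rewrite -rmorphB normc_def /= expr0n addr0 sqrtr_sqr e20.
by rewrite ltcE /= eqxx.
Qed.

Lemma l2_cvg (x : l2) : cvgn (series (fun j => mu j * normc (x j) ^+ 2)).
Proof. by have /asboolP := l2_valP x. Qed.

Lemma l2_innerE (x : l2) : l2_inner x x =
  (limn (series (fun j => mu j * normc (x j) ^+ 2)))%:C%C.
Proof.
apply/cvg_lim; first exact: norm_hausdorff.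
rewrite (_ : series _ = fun n => (series (fun j => mu j * normc (x j) ^+ 2) n)%:C%C).
  exact/cvg_real_complex/l2_cvg.
apply/funext => n; rewrite /series /= rmorph_sum; apply: eq_bigr => j _.
by rewrite -mulrA -sqr_normc rmorphM rmorphXn.
Qed.

Lemma l2_normE (x : l2) : l2_norm x =
  Num.sqrt (limn (series (fun j => mu j * normc (x j) ^+ 2))).
Proof. by rewrite /l2_norm l2_innerE. Qed.

Lemma l2_normE2 (x : l2) :
  l2_norm x ^+ 2 = limn (series (fun j => mu j * normc (x j) ^+ 2)).
Proof.
rewrite l2_normE sqr_sqrtr//; apply: limr_ge; first exact: l2_cvg.
by near=> n; apply: sumr_ge0 => j _; exact: l2_term_ge0.
Unshelve. all: by end_near. Qed.

Lemma l2_coord_le (x : l2) j : mu j * normc (x j) ^+ 2 <= l2_norm x ^+ 2.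
Proof.
rewrite l2_normE2; set u := (fun j => _).
apply: (@le_trans _ _ (series u j.+1)).
  rewrite seriesSr -[leLHS]add0r lerD//.
  by apply: sumr_ge0 => i _; exact: l2_term_ge0.
apply: nondecreasing_cvgn_le; last exact: l2_cvg.
by apply: nondecreasing_series => i _ _; exact: l2_term_ge0.
Qed.

Definition l2_trunc (x : l2) (m : nat) : l2 :=
  \sum_(0 <= k < m) x k *: l2_delta k.

Lemma l2_truncE (x : l2) m i : (x - l2_trunc x m) i = if (i < m)%N then 0 else x i.
Proof.
have -> : (x - l2_trunc x m) i = x i - l2_trunc x m i by [].
have -> : l2_trunc x m i = if (i < m)%N then x i else 0.
  rewrite /l2_trunc (@big_morph _ _ (fun y : l2 => y i) 0 +%R)//.
  rewrite (eq_bigr (fun k => x k * (i == k)%:R))//.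
  case: ltnP => im.
    rewrite (bigD1_seq i)/= ?iota_uniq ?mem_index_iota//.
    rewrite eqxx mulr1 big1 ?addr0// => k ki.
    by rewrite eq_sym (negbTE ki) mulr0.
  rewrite big1_seq// => k /andP[_]; rewrite mem_index_iota => /andP[_ km].
  by rewrite gtn_eqF ?mulr0// (leq_trans km).
by case: ifP; rewrite ?subrr ?subr0.
Qed.

Lemma l2_norm_trunc (x : l2) m : l2_norm (x - l2_trunc x m) ^+ 2 =
  l2_norm x ^+ 2 - series (fun j => mu j * normc (x j) ^+ 2) m.
Proof.
rewrite !l2_normE2; apply/cvg_lim; first exact: norm_hausdorff.
set u := (fun j => mu j * normc (x j) ^+ 2).
apply: (@cvg_trans _ ((fun n => series u n - series u m) @ \oo)); last first.
  by apply: cvgB; [exact: l2_cvg|exact: cvg_cst].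
apply: near_eq_cvg; exists m => // n /= mn.
rewrite sub_series_geq// [RHS]/series /= (@big_cat_nat _ _ _ m 0 n)//=.
rewrite [X in _ = X + _]big1_seq ?add0r.
  apply: eq_big_nat => k /andP[mk _].
  rewrite /u; congr (_ * normc _ ^+ 2).
  by have := l2_truncE x m k; rewrite ltnNge mk.
move=> k /andP[_]; rewrite mem_index_iota => /andP[_ km].
have t0 := l2_truncE x m k; rewrite km in t0.
transitivity (mu k * normc (0 : R[i]) ^+ 2); first by congr (_ * normc _ ^+ 2).
by rewrite -[LHS]/(mu k * normc 0%C ^+ 2) normc0 expr0n mulr0.
Qed.

Lemma mxentryP (U : {linear l2 -> l2}) : is_l2_contraction U ->
  forall (x : l2) (j : nat),
  series (fun k => mxentry U j k * x k) @ \oo --> (U x j : R[i]).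
Proof.
move=> cU x j; apply/cvgrPdist_lt => -[e1 e2] e0.
have [/eqP -> e10] : e2 == 0 /\ 0 < e1.
  by move: e0; rewrite ltcE /= => /andP[].
have pe : 0 < mu j * e1 ^+ 2 by rewrite mulr_gt0 ?weight_gt0 ?exprn_gt0.
have /cvgrPdist_lt /(_ _ pe) := @l2_cvg x.
apply: filterS => m; rewrite -l2_normE2 -l2_norm_trunc.
rewrite ger0_norm ?sqr_ge0// => h.
have -> : U x j - series (fun k => mxentry U j k * x k) m =
    U (x - l2_trunc x m) j.
  rewrite linearB /=; congr (_ - _).
  rewrite /l2_trunc linear_sum (@big_morph _ _ (fun y : l2 => y j) 0 +%R)//.
  by apply: eq_bigr => k _; rewrite linearZ mulrC.
set z := U _ j.
have zE : `|z| = (normc z)%:C%C by case: (z) => ? ?; rewrite normc_def.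
have : mu j * normc z ^+ 2 < mu j * e1 ^+ 2.
  apply: le_lt_trans (l2_coord_le _ j) _; apply: le_lt_trans h.
  by rewrite ler_sqr ?nnegrE ?sqrtr_ge0// cU.
rewrite ltr_pM2l ?weight_gt0// => ze.
have z0 : 0 <= normc z by case: (z) => ? ?; exact: sqrtr_ge0.
by rewrite zE ltcE /= eqxx -ltr_sqr ?nnegrE// ltW.
Qed.

End l2_space.

Section walk_entropy.
Context {R : realType} (mu : prob_weight R) (U : {linear l2 mu -> l2 mu}).

(* A finite collection X_0, ..., X_K, given as a family. As for the sets of a
   collection, members may be empty (only the empty set can be repeated). *)
Definition is_partition (K : nat) (X : 'I_K.+1 -> set nat) : Prop :=
  trivIset [set: 'I_K.+1] X /\ cover [set: 'I_K.+1] X = [set: nat].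

Definition is_subpartition (L K : nat)
    (Y : 'I_L.+1 -> set nat) (X : 'I_K.+1 -> set nat) : Prop :=
  forall l, exists k, Y l `<=` X k.

(* lift ord0 m is m + 1 and widen_ord _ m is m, as indices in {0, ..., n}. *)
Definition path_weight (K n : nat) (X : 'I_K.+1 -> set nat)
    (s : {ffun 'I_n.+1 -> 'I_K.+1}) (j : {ffun 'I_n.+1 -> nat}) : R :=
  (\prod_(m < n.+1) \1_(X (s m)) (j m)) *
  (\prod_(m < n) Bmx U (j (lift ord0 m)) (j (widen_ord (leqnSn n) m))) *
  mu (j ord0).

(* A sum of nonnegative terms, so the order of summation is irrelevant. For a
   contraction, \sum_j B_jk = |U e_k|^2 / mu_k <= 1 for every k, so the sum is
   at most \sum_j mu_j = 1 and fine loses nothing. *)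
Definition I_U (K n : nat) (X : 'I_K.+1 -> set nat)
    (s : {ffun 'I_n.+1 -> 'I_K.+1}) : R :=
  fine (\esum_(j in [set: {ffun 'I_n.+1 -> nat}]) (path_weight X s j)%:E).

(* ln is total and the product with I_U vanishes when I_U = 0, which is the
   convention 0 log 0 = 0. *)
Definition walk_entropy (K : nat) (X : 'I_K.+1 -> set nat) (n : nat) : R :=
  - \sum_(s : {ffun 'I_n.+1 -> 'I_K.+1}) I_U X s * ln (I_U X s).

End walk_entropy.

(* Main.v *)
(* Each member of chi is the disjoint union of the members of kappa which it
   contains, so the weight of a coarse word sigma is the sum of the weights of
   the fine words lying over it. These weights are finite because the columns
   of B have sums |U e_k|^2 / mu_k <= 1, and x |-> - x ln x is subadditive on
   the nonnegative reals. *)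
Require Import Defs.
From HB Require Import structures.
From mathcomp Require Import all_boot all_order all_algebra.
From mathcomp Require Import complex.
From mathcomp Require Import all_classical all_reals all_analysis.

Import Order.TTheory GRing.Theory Num.Theory.
Import numFieldNormedType.Exports.
Local Open Scope classical_set_scope.
Local Open Scope ring_scope.

(** Each nonzero [a i] is positive and at most the total, so monotonicity of [ln] gives the bound
    term by term. *)
Lemma sum_xlnx_le (R : realType) (I : finType) (P : pred I) (a : I -> R) :
  (forall i, 0 <= a i) ->
  \sum_(i | P i) a i * ln (a i) <=
  (\sum_(i | P i) a i) * ln (\sum_(i | P i) a i).
Proof.
move=> a_ge0; rewrite mulr_suml; apply: ler_sum => i Pi.
have [->|ai_neq0] := eqVneq (a i) 0; first by rewrite !mul0r.
have ai_gt0 : 0 < a i by rewrite lt_def ai_neq0 a_ge0.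
have le_sum : a i <= \sum_(j | P j) a j.
  by rewrite (bigD1 i)//= lerDl sumr_ge0.
by rewrite ler_wpM2l// ler_ln// posrE// (lt_le_trans ai_gt0).
Qed.

(** * Decomposition of coarse words into fine words *)

Section refinement.
Context {R : realType} {K L : nat}.
Context {X : 'I_K.+1 -> set nat} {Y : 'I_L.+1 -> set nat}.
Hypotheses (X_partition : is_partition X) (Y_partition : is_partition Y).
Context {f : 'I_L.+1 -> 'I_K.+1}.
Hypothesis subYX : forall l, Y l `<=` X (f l).

(** The point [x] lies in exactly one [Y l], hence in [X (f l)], and by disjointness in no other
    member of [X]. Empty members, for which [f] is an arbitrary choice, contribute 0. *)
Lemma indic_refine (k : 'I_K.+1) (x : nat) :
  \1_(X k) x = \sum_(l | f l == k) \1_(Y l) x :> R.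
Proof.
case: X_partition => tX _; case: Y_partition => tY coverY.
have : cover [set: 'I_L.+1] Y x by rewrite coverY.
case=> l _ Ylx.
have Y0 i : i != l -> \1_(Y i) x = 0 :> R.
  move=> il; rewrite indicE memNset// => Yix.
  by move/eqP: il; apply; apply: tY => //; exists x.
have [flk|flk] := eqVneq (f l) k.
  rewrite (bigD1 l)/= ?flk// big1 => [|i /andP[_ /Y0//]].
  by rewrite !indicE !mem_set ?addr0// -flk; exact: subYX.
rewrite big1 => [|i /eqP fik].
  rewrite indicE memNset// => Xkx; move/eqP: flk; apply.
  by apply: tX => //; exists x; split => //; exact: subYX.
by apply: Y0; apply: contraNneq flk => <-; rewrite fik.
Qed.

Lemma path_weight_refine {mu : prob_weight R} (U : {linear l2 mu -> l2 mu})
    (n : nat) (s : {ffun 'I_n.+1 -> 'I_K.+1}) (j : {ffun 'I_n.+1 -> nat}) :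
  path_weight U X s j =
  \sum_(t : {ffun 'I_n.+1 -> 'I_L.+1} | [ffun m => f (t m)] == s)
    path_weight U Y t j.
Proof.
rewrite /path_weight -!mulr_suml; congr (_ * _ * _).
under eq_bigr do rewrite indic_refine.
(* Expanding the product over times of sums over cells gives one term per word [t] with
   [f (t m) = s m] at every time [m]. *)
rewrite bigA_distr_big_dep; apply: eq_bigl => t.
apply/familyP/eqP => [ts|<- m].
  by apply/ffunP => m; rewrite ffunE; apply/eqP/ts.
by rewrite -topredE/= ffunE.
Qed.

End refinement.

(** * Finiteness of the path sums *)

Section total_mass.
Context {R : realType} {mu : prob_weight R} {U : {linear l2 mu -> l2 mu}}.
Hypothesis U_contraction : is_l2_contraction U.

Lemma Bmx_ge0 j k : 0 <= Bmx U j k.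
Proof. by rewrite mulr_ge0 ?sqr_ge0// divr_ge0// ltW// weight_gt0. Qed.

Lemma l2_norm_delta k : l2_norm (l2_delta mu k) ^+ 2 = mu k.
Proof.
rewrite l2_normE2; apply/cvg_lim; first exact: norm_hausdorff.
apply: cvg_near_cst; exists k.+1 => // n /= kn.
have delta0 j : j != k ->
    mu j * ComplexField.Normc.normc (l2_delta mu k j) ^+ 2 = 0.
  move=> jk; have -> : l2_delta mu k j = 0%C by rewrite /= (negbTE jk).
  by rewrite ComplexField.Normc.normc0 expr0n mulr0.
rewrite /series /= (bigD1_seq k)/= ?iota_uniq ?mem_index_iota//.
rewrite big1 => [|j /delta0//]; rewrite eqxx.
by rewrite ComplexField.Normc.normc1 expr1n mulr1 addr0.
Qed.

(** Multiplied by [mu k], the left side is a partial sum of the series for the squared norm of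
    [U (l2_delta mu k)], which contractivity bounds by that of [l2_delta mu k], namely [mu k]. *)
Lemma sum_Bmx_le1 k m : \sum_(0 <= j < m) Bmx U j k <= 1.
Proof.
have mu0 := weight_gt0 mu k.
pose u j := mu j * ComplexField.Normc.normc (U (l2_delta mu k) j) ^+ 2.
rewrite (eq_bigr (fun j => (mu k)^-1 * u j)) => [|j _]; last first.
  by rewrite /Bmx [RHS]mulrA [(mu k)^-1 * mu j]mulrC.
rewrite -mulr_sumr mulrC ler_pdivrMr// mul1r -l2_norm_delta.
apply: (@le_trans _ _ (l2_norm (U (l2_delta mu k)) ^+ 2)); last first.
  by rewrite ler_sqr ?nnegrE ?sqrtr_ge0// U_contraction.
rewrite l2_normE2 -[leLHS]/(series u m).
apply: nondecreasing_cvgn_le; last exact: l2_cvg.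
by apply: nondecreasing_series => i _ _; exact: l2_term_ge0.
Qed.

Lemma esum_Bmx_le k (c : R) : 0 <= c ->
  (\esum_(j in [set: nat]) (Bmx U j k * c)%:E <= c%:E)%E.
Proof.
move=> c0; have B0 j : (0 <= (Bmx U j k * c)%:E)%E.
  by rewrite lee_fin mulr_ge0// Bmx_ge0.
rewrite -nneseries_esumT//; apply: lime_le; first exact: is_cvg_nneseries.
near=> m; rewrite sumEFin lee_fin -mulr_suml -[leRHS]mul1r.
by rewrite ler_wpM2r// sum_Bmx_le1.
Unshelve. all: by end_near. Qed.

(** The path weight without the cell constraints: it dominates [path_weight U X s] for every word
    [s]. *)
Definition walk_weight (n : nat) (j : {ffun 'I_n.+1 -> nat}) : R :=
  (\prod_(m < n) Bmx U (j (lift ord0 m)) (j (widen_ord (leqnSn n) m))) *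
  mu (j ord0).

Lemma walk_weight_ge0 n (j : {ffun 'I_n.+1 -> nat}) : 0 <= walk_weight n j.
Proof.
rewrite mulr_ge0 ?(ltW (weight_gt0 _ _))// prodr_ge0// => m _.
exact: Bmx_ge0.
Qed.

(** A path is extended at its final time, so that the new position enters only one factor, as a row
    index of [Bmx], and can be summed out by the column bound. *)
Definition ffun_rcons (n : nat) (p : {ffun 'I_n.+1 -> nat} * nat) :
    {ffun 'I_n.+2 -> nat} :=
  [ffun i => if unlift ord_max i is Some i' then p.1 i' else p.2].

Lemma ffun_rcons_max n p : ffun_rcons n p ord_max = p.2.
Proof. by rewrite ffunE unlift_none. Qed.

Lemma ffun_rcons_widen n p (i : 'I_n.+1) :
  ffun_rcons n p (widen_ord (leqnSn n.+1) i) = p.1 i.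
Proof.
have -> : widen_ord (leqnSn n.+1) i = lift ord_max i.
  by apply: val_inj; rewrite /= /bump leqNgt ltn_ord.
by rewrite ffunE liftK.
Qed.

Lemma ffun_rcons_bij n : set_bij ([set: {ffun 'I_n.+1 -> nat}] `*`` fun=> setT)
  [set: {ffun 'I_n.+2 -> nat}] (ffun_rcons n).
Proof.
split => // [[p x] [q y] _ _ pq|j _].
  congr (_, _); last first.
    by rewrite -[x](ffun_rcons_max n (p, x)) pq ffun_rcons_max.
  apply/ffunP => i.
  by rewrite -[p i](ffun_rcons_widen n (p, x)) pq ffun_rcons_widen.
exists ([ffun i => j (lift ord_max i)], j ord_max) => //.
apply/ffunP => i; rewrite ffunE.
by case: unliftP => [i' ->|->] //=; rewrite ffunE.
Qed.

Lemma walk_weight_rcons n p :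
  walk_weight n.+1 (ffun_rcons n p) =
  Bmx U p.2 (p.1 ord_max) * walk_weight n p.1.
Proof.
rewrite /walk_weight big_ord_recr/=.
have -> : lift ord0 ord_max = ord_max :> 'I_n.+2 by exact: val_inj.
rewrite ffun_rcons_max ffun_rcons_widen.
have -> : ord0 = widen_ord (leqnSn n.+1) ord0 :> 'I_n.+2 by exact: val_inj.
rewrite ffun_rcons_widen -mulrA [RHS]mulrCA; congr (_ * _).
apply: eq_bigr => m _; rewrite ffun_rcons_widen; congr (Bmx U _ _).
(* Shifting by one and widening commute: both indices have value [m + 1]. *)
by rewrite -ffun_rcons_widen; congr (ffun_rcons n p _); exact: val_inj.
Qed.

Lemma esum_walk_weight_lty n :
  (\esum_(j in [set: {ffun 'I_n.+1 -> nat}]) (walk_weight n j)%:E < +oo)%E.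
Proof.
elim: n => [|n].
  rewrite (reindex_esum [set: nat] _ (fun x => [ffun=> x])); last first.
    split => // [x y _ _ /ffunP/(_ ord0)|j _]; first by rewrite !ffunE.
    by exists (j ord0) => //; apply/ffunP => i; rewrite ffunE (ord1 i).
  rewrite -nneseries_esumT => [|x]; last by rewrite lee_fin walk_weight_ge0.
  rewrite (eq_eseriesr (g := EFin \o mu)) => [|x _]; last first.
    by rewrite /walk_weight big_ord0 mul1r ffunE.
  rewrite (_ : limn _ = 1%E) ?ltry//; apply/cvg_lim => //.
  rewrite (_ : (fun _ => _) = EFin \o series mu); last first.
    by apply/funext => m; rewrite /= sumEFin.
  by apply: cvg_EFin; [exact: nearW|exact: weight_sum1].
(* By the induction hypothesis it suffices that the total mass does not increase with [n]: the last
   position is summed first, and its column of [Bmx] has sum at most 1. *)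
apply: le_lt_trans; rewrite (reindex_esum _ _ _ _ (ffun_rcons_bij n)).
under eq_esum do rewrite walk_weight_rcons.
rewrite -(@esum_esum _ _ _ _ _
  (fun (j : {ffun 'I_n.+1 -> nat}) x =>
    (Bmx U x (j ord_max) * walk_weight n j)%:E)) => [|j x _ _].
  by apply: le_esum => j _; exact/esum_Bmx_le/walk_weight_ge0.
by rewrite lee_fin mulr_ge0 ?Bmx_ge0 ?walk_weight_ge0.
Qed.

Context {K : nat} {X : 'I_K.+1 -> set nat}.

Lemma path_weightE n s (j : {ffun 'I_n.+1 -> nat}) :
  path_weight U X s j = (\prod_(m < n.+1) \1_(X (s m)) (j m)) * walk_weight n j.
Proof. by rewrite /path_weight /walk_weight mulrA. Qed.

Lemma path_weight_ge0 n s (j : {ffun 'I_n.+1 -> nat}) :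
  0 <= path_weight U X s j.
Proof. by rewrite path_weightE mulr_ge0 ?walk_weight_ge0// prodr_ge0. Qed.

(** The indicators are at most 1, so the total mass of the unconstrained paths is a bound.
    Finiteness is what lets [fine] commute with the sum over fine words. *)
Lemma esum_path_weight_fin_num n (s : {ffun 'I_n.+1 -> 'I_K.+1}) :
  (\esum_(j in [set: {ffun 'I_n.+1 -> nat}]) (path_weight U X s j)%:E)%E
    \is a fin_num.
Proof.
rewrite ge0_fin_numE; last first.
  by apply: esum_ge0 => j _; rewrite lee_fin path_weight_ge0.
apply: le_lt_trans (esum_walk_weight_lty n); apply: le_esum => j _.
rewrite lee_fin path_weightE ler_piMl ?walk_weight_ge0//.
apply: prodr_ile1 => m _.
by rewrite indicE; case: (_ \in _); rewrite ?lexx ler01.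
Qed.

Lemma I_U_ge0 n (s : {ffun 'I_n.+1 -> 'I_K.+1}) : 0 <= I_U U X s.
Proof. by apply/fine_ge0/esum_ge0 => j _; rewrite lee_fin path_weight_ge0. Qed.

End total_mass.

Theorem lemma5p3 (R : realType) (mu : prob_weight R)
    (U : {linear l2 mu -> l2 mu}) (U_contraction : is_l2_contraction U)
    (K L : nat) (chi : 'I_K.+1 -> set nat) (kappa : 'I_L.+1 -> set nat)
    (chi_partition : is_partition chi) (kappa_partition : is_partition kappa)
    (kappa_sub_chi : is_subpartition kappa chi)
    (n : nat) (n_ge1 : (1 <= n)%N) :
  walk_entropy U chi n <= walk_entropy U kappa n.
Proof.
have [f subf] := choice kappa_sub_chi.
pose pr (t : {ffun 'I_n.+1 -> 'I_L.+1}) : {ffun 'I_n.+1 -> 'I_K.+1} :=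
  [ffun m => f (t m)].
(* Grouping the fine words by the coarse word below them reduces the claim to one coarse word [s] at
   a time. *)
rewrite lerN2 (partition_big pr predT)//=; apply: ler_sum => s _.
have -> : I_U U chi s = \sum_(t | pr t == s) I_U U kappa t.
  rewrite /I_U sum_fine => [|t _]; last exact: esum_path_weight_fin_num.
  rewrite -esum_sum => [|j t _ _]; last by rewrite lee_fin path_weight_ge0.
  congr fine; apply: eq_esum => j _.
  by rewrite (path_weight_refine chi_partition kappa_partition subf) sumEFin.
by apply: sum_xlnx_le => t; exact: I_U_ge0.
Qed.
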